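(* Let $k\ge 3$ be an integer. For every even positive integer $r$, \begin{align*} SIN(r)=&\frac{(-1)^{\frac r2+1}2^rB_r}{r!}J_r(k)+\frac{(-1)^{\frac r2}2^rk^{r-1}}{r!}\sum_{q=0}^{r}\binom rq\frac{B_q}{k^{r-q}}\sum_{j=1}^{r-q}\binom{r-q}{j}k^j\Bigg[\sum_{\alpha=1}^{r-q-j+1}A_{r-q-j,\alpha}\\ &\times E(\alpha)\sum_{c=0}^{\left[\frac{\alpha}{2}\right]}\frac{(-1)^{c+\left[\frac{\alpha+1}{2}\right]}(\alpha-c-1)!}{2^{2c+1}c!\left(2\left[\frac{\alpha}{2}\right]-2c\right)!}\sum_{\substack{d=0\\ \alpha-2d\ne r}}^{\left[\frac{\alpha}{2}\right]-c}(-1)^d\binom{\left[\frac{\alpha}{2}\right]-c}{d}SIN\left(2\left[\frac{\alpha}{2}\right]-2d\right)\Bigg], \end{align*} where $E(\alpha)=\alpha$ if $\alpha$ is even and $E(\alpha)=1$ if $\alpha$ is odd.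
   Context: For an integer $n\ge 0$ (with $k$ fixed), $$SIN(n):=\sum_{\substack{1\le m\le k\\ (m,k)=1}}\frac{1}{\left(\sin\left(\frac{\pi m}{k}\right)\right)^{n}},$$ so $SIN(0)=\phi(k)$, where $\phi$ is Euler's totient function. For integers $q\ge 0$ and $1\le j\le q+1$, $$A_{q,j}:=\sum_{t=0}^{j-1}(-1)^{t+q}\binom{j-1}{t}(j-t)^q .$$ $J_r(k):=k^r\prod_{p\mid k,\ p\text{ prime}}\left(1-\frac1{p^r}\right)$ is the Jordan totient function. $B_n$ denotes the $n$th Bernoulli number, with $B_0=1$, $B_1=-\frac12$. $[x]$ denotes the greatest integer not exceeding $x$. Empty sums (for instance the sum over $j$ when $q=r$) are $0$. *)

(* Defs.v *)
From mathcomp Require Import all_boot all_order all_algebra.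
From mathcomp Require Import all_classical all_reals all_analysis.

Set Implicit Arguments.
Unset Strict Implicit.
Unset Printing Implicit Defensive.

Import Order.TTheory GRing.Theory Num.Theory.

Local Open Scope ring_scope.

(* The Bernoulli numbers are computed from the standard recurrence
     B_0 = 1,  B_n = - (n + 1)^-1 * \sum_(i < n) 'C(n + 1, i) * B_i  (n > 0),
   which yields B_1 = -1/2; bernoulli_seq R n is [:: B_0; ...; B_n]. *)
Fixpoint bernoulli_seq (R : numFieldType) (n : nat) : seq R :=
  if n is m.+1 then
    let s := bernoulli_seq R m in
    rcons s (- (\sum_(i < m.+1) 'C(m.+2, i)%:R * s`_i) / m.+2%:R)
  else [:: 1].

Definition bernoulli_number (R : numFieldType) (n : nat) : R :=
  (bernoulli_seq R n)`_n.

Lemma size_bernoulli_seq (R : numFieldType) (n : nat) :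
  size (bernoulli_seq R n) = n.+1.
Proof. by elim: n => //= n IHn; rewrite size_rcons IHn. Qed.

Lemma nth_bernoulli_seq (R : numFieldType) (n i : nat) :
  (i <= n)%N -> (bernoulli_seq R n)`_i = bernoulli_number R i.
Proof.
elim: n => [|n IHn]; first by rewrite leqn0 => /eqP ->.
rewrite leq_eqVlt => /orP[/eqP -> //|lt_in].
by rewrite /= nth_rcons size_bernoulli_seq lt_in IHn.
Qed.

Lemma bernoulli_number_rec (R : numFieldType) (n : nat) :
  \sum_(i < n.+1) 'C(n.+1, i)%:R * bernoulli_number R i = (n == 0%N)%:R.
Proof.
case: n => [|n]; first by rewrite big_ord1 bin0 mul1r.
rewrite big_ord_recr /= {2}/bernoulli_number /= nth_rcons size_bernoulli_seq.
rewrite ltnn eqxx binSn [X in _ + X]mulrC divfK ?pnatr_eq0 //.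
apply/eqP; rewrite subr_eq0; apply/eqP; apply: eq_bigr => i _.
by rewrite nth_bernoulli_seq // -ltnS ltn_ord.
Qed.

Lemma bernoulli_number0 (R : numFieldType) : bernoulli_number R 0 = 1.
Proof. by []. Qed.

Lemma bernoulli_number1 (R : numFieldType) : bernoulli_number R 1 = - 2^-1.
Proof. by rewrite /bernoulli_number /= big_ord1 bin0 /= mul1r mulN1r. Qed.

Definition SIN (R : realType) (k n : nat) : R :=
  \sum_(1 <= m < k.+1 | coprime m k) 1 / sin (pi * m%:R / k%:R) ^+ n.

Definition A_coef (R : realType) (q j : nat) : R :=
  \sum_(0 <= t < j) (-1) ^+ (t + q) * 'C(j - 1, t)%:R * (j - t)%:R ^+ q.

Definition jordan_totient (R : realType) (r k : nat) : R :=
  k%:R ^+ r * \prod_(p <- primes k) (1 - 1 / p%:R ^+ r).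

Definition E_factor (R : realType) (a : nat) : R := if odd a then 1 else a%:R.

(* Main.v *)
Require Import Defs.
From mathcomp Require Import all_boot all_order all_algebra.
From mathcomp Require Import all_classical all_reals all_analysis.
From mathcomp Require Import ring zify.

Set Implicit Arguments.
Unset Strict Implicit.
Unset Printing Implicit Defensive.

Import Order.TTheory GRing.Theory Num.Theory.

Local Open Scope ring_scope.

(** For [z = exp (2 pi i m / k)] with [m] prime to [k], sum
    [k^(r-1) B_r(n/k) z^n] over [n < k] and over [m] in two ways.
    - Without the coprimality condition the sum over [m < k] is [k^r B_r], and by the
      multiplication theorem for [B_r(x)] the summand for [(p m, p k)] equals the one for
      [(m, k)]; sieving by the primes of [k] turns [k^r B_r] into [B_r J_r(k)].
    - Expanding [B_r(n/k)] in powers of [n], summation by parts expresses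
      [\sum_n n^s z^n] through the powers [(z - 1)^(-a)] with coefficients [A_coef],
      because [z^n (z - 1)^(-a-1)] is an antidifference of [z^n (z - 1)^(-a)] in [n].
      The real part of [(z - 1)^(-a)] is [cos (a t)] or [sin (a t)], with [t = pi m / k],
      divided by [(2 sin t)^a] up to sign, hence by Chebyshev's formulas a combination of
      even powers of [1 / sin t].
    In the resulting identity [SIN r] comes only from [a = r]; solve for it. *)

(** * Alternating differences and summation by parts *)

Section AlternatingDifferences.
Variable C : comNzRingType.
Implicit Types (c : C) (M s a k n : nat).

Definition altdiff M (u : nat -> C) : C :=
  \sum_(t < M.+1) (-1) ^+ t * 'C(M, t)%:R * u t.

Lemma eq_altdiff M (u v : nat -> C) : u =1 v -> altdiff M u = altdiff M v.
Proof. by move=> uv; apply: eq_bigr => t _; rewrite uv. Qed.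

Lemma altdiffD M (u v : nat -> C) :
  altdiff M (fun t => u t + v t) = altdiff M u + altdiff M v.
Proof. by rewrite -big_split; apply: eq_bigr => t _; rewrite mulrDr. Qed.

Lemma altdiffZ M c (u : nat -> C) :
  altdiff M (fun t => c * u t) = c * altdiff M u.
Proof. by rewrite mulr_sumr; apply: eq_bigr => t _; rewrite mulrCA. Qed.

Lemma altdiff_sum M (I : Type) (r : seq I) (P : pred I) (u : I -> nat -> C) :
  altdiff M (fun t => \sum_(i <- r | P i) u i t) =
  \sum_(i <- r | P i) altdiff M (u i).
Proof.
rewrite exchange_big /=; apply: eq_bigr => t _.
by rewrite mulr_sumr.
Qed.

Lemma altdiffS M (u : nat -> C) :
  altdiff M.+1 u = altdiff M u - altdiff M (fun t => u t.+1).
Proof.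
rewrite /altdiff big_ord_recl /= [in RHS]big_ord_recl /= !bin0.
under eq_bigr do rewrite /bump /= add1n binS natrD mulrDr mulrDl.
rewrite big_split /= -[RHS]addrA; congr (_ + _); congr (_ + _).
  by rewrite big_ord_recr /= bin_small // mulr0 mul0r addr0.
by rewrite -sumrN; apply: eq_bigr => t _; rewrite exprS !mulN1r !mulNr.
Qed.

(** Induction on [M]: in the difference of [(c + t) ^ s] and [(c + t + 1) ^ s] the leading powers
    cancel, and among the lower ones only the exponent [M], present when [s = M + 1], survives the
    remaining [M] differences. *)
Lemma altdiff_exp M s c : (s <= M)%N ->
  altdiff M (fun t => (c + t%:R) ^+ s) = ((-1) ^+ M * M`!%:R) *+ (s == M).
Proof.
elim: M s c => [|M IH] s c.
  rewrite leqn0 => /eqP ->; rewrite /altdiff big_ord1 /= bin0 !expr0.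
  by rewrite !mulr1 ?eqxx ?mulr1n.
move=> sM; rewrite altdiffS.
have -> : altdiff M (fun t => (c + t.+1%:R) ^+ s) =
    \sum_(i < s) 'C(s, i)%:R * altdiff M (fun t => (c + t%:R) ^+ i)
    + altdiff M (fun t => (c + t%:R) ^+ s).
  under eq_bigr do rewrite -altdiffZ.
  rewrite -altdiff_sum -altdiffD; apply: eq_altdiff => t.
  have -> : c + t.+1%:R = 1 + (c + t%:R) by rewrite mulrSr; ring.
  rewrite exprDn big_ord_recr /= subnn expr0 mul1r binn mulr1n.
  by congr (_ + _); apply: eq_bigr => i _; rewrite expr1n mul1r mulr_natl.
rewrite opprD addrCA subrr addr0.
case: (eqVneq s M.+1) sM => [-> _|nsM sM]; last first.
  rewrite big1 ?oppr0 // => i _; rewrite IH; last first.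
    by have := ltn_ord i; lia.
  have -> : (i == M :> nat) = false by apply/eqP; have := ltn_ord i; lia.
  by rewrite mulr0.
rewrite big_ord_recr /= big1 => [|i _]; last first.
  rewrite IH; last by rewrite ltnW.
  by rewrite ltn_eqF // mulr0.
rewrite IH // eqxx add0r mulr1n binSn factS natrM exprS; ring.
Qed.

(** Up to the sign [(-1) ^ a], the [a]-th backward difference of [f] at [-1]; the sample points
    [-a-1, ..., -1] are those that produce [A_coef]. *)
Definition bdiff a (f : C -> C) : C := altdiff a (fun t => f (t%:R - a.+1%:R)).

Lemma bdiff_rec a (f : C -> C) :
  bdiff a f = bdiff a (fun x => f (x + 1)) + bdiff a.+1 (fun x => f (x + 1)).
Proof.
rewrite /bdiff altdiffS addrC -addrA.
have -> : altdiff a (fun t => f (t.+1%:R - a.+2%:R + 1)) =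
          altdiff a (fun t => f (t%:R - a.+1%:R + 1)).
  by apply: eq_altdiff => t; congr (f _); rewrite (mulrSr 1 t) (mulrSr 1 a.+1); ring.
rewrite addNr addr0; apply: eq_altdiff => t; congr (f _).
by rewrite (mulrSr 1 a.+1); ring.
Qed.

Lemma bdiff0 (f : C -> C) : bdiff 0 f = f (- 1).
Proof. by rewrite /bdiff /altdiff big_ord1 /= bin0 !mul1r sub0r. Qed.

Lemma bdiff_exp_eq0 a s c : (s < a)%N -> bdiff a (fun x => (x + c) ^+ s) = 0.
Proof.
move=> sa; rewrite /bdiff.
under eq_altdiff => t do rewrite -addrA [t%:R + _]addrC.
by rewrite altdiff_exp ?(ltnW sa) // ltn_eqF.
Qed.

(* Summation by parts, with iterated antidifferences [h _ 1], [h _ 2], ... of [h _ 0]. *)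
Lemma sum_by_parts (h : nat -> nat -> C) (f : C -> C) M N :
  (forall n a, h n.+1 a.+1 = h n a.+1 + h n a) ->
  (forall c, bdiff M (fun x => f (x + c)) = 0) ->
  \sum_(n < N) f n%:R * h n 0%N =
  \sum_(a < M) bdiff a (fun x => f (x + N%:R)) * h N a.+1
  - \sum_(a < M) bdiff a f * h 0%N a.+1.
Proof.
move=> hE fM; elim: N => [|N IH].
  rewrite big_ord0; apply/esym/eqP; rewrite subr_eq0; apply/eqP.
  apply: eq_bigr => a _; congr (_ * _).
  by apply: eq_altdiff => t; rewrite addr0.
rewrite big_ord_recr /= IH addrAC; congr (_ - _).
pose g x := f (x + N%:R).
have gE x : f (x + N.+1%:R) = g (x + 1) by rewrite /g mulrS addrA.
have -> : \sum_(a < M) bdiff a (fun x => f (x + N.+1%:R)) * h N.+1 a.+1 =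
    \sum_(a < M) bdiff a (fun x => g (x + 1)) * h N a.+1 +
    \sum_(a < M) bdiff a (fun x => g (x + 1)) * h N a.
  rewrite -big_split; apply: eq_bigr => a _ /=; rewrite hE mulrDr.
  by have -> : bdiff a (fun x => f (x + N.+1%:R)) = bdiff a (fun x => g (x + 1))
    by apply: eq_altdiff => t.
have -> : \sum_(a < M) bdiff a (fun x => f (x + N%:R)) * h N a.+1 =
    \sum_(a < M) bdiff a (fun x => g (x + 1)) * h N a.+1 +
    \sum_(a < M) bdiff a.+1 (fun x => g (x + 1)) * h N a.+1.
  rewrite -big_split; apply: eq_bigr => a _ /=.
  by rewrite -mulrDl -bdiff_rec.
rewrite -addrA; congr (_ + _).
(* The same sum over [a <= M] is split at either end: its first term is the new summand
   [f N * h N 0], its last one vanishes by [fM]. *)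
have : \sum_(a < M.+1) bdiff a (fun x => g (x + 1)) * h N a =
       \sum_(a < M.+1) bdiff a (fun x => g (x + 1)) * h N a by [].
rewrite {1}big_ord_recl big_ord_recr /=.
have -> : bdiff M (fun x => g (x + 1)) = 0.
  by rewrite -[RHS](fM N.+1%:R); apply: eq_altdiff => t; rewrite gE.
rewrite mul0r addr0 => <-; rewrite addrC bdiff0.
by rewrite /g addNr add0r.
Qed.

End AlternatingDifferences.

(** * Power sums weighted by a periodic sequence *)

Section PowerSums.
Variable R : realType.

(** Moving [(-1) ^ q] into the power turns [(j - t) ^ q] into [(t - j) ^ q], the monomial at the
    sample points of [bdiff]. *)
Lemma A_coefE q a : A_coef R q a.+1 = bdiff a (fun x : R => x ^+ q).
Proof.
rewrite /A_coef big_mkord; apply: eq_bigr => t _; rewrite subn1 /=.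
have ta : (t <= a.+1)%N by rewrite ltnW.
rewrite -opprB -(natrB _ ta) [(- _) ^+ q]exprNn exprD -!mulrA.
by congr (_ * _); rewrite mulrCA.
Qed.

Lemma A_coef_eq0 q a : (q.+1 < a)%N -> A_coef R q a = 0.
Proof.
case: a => // a qa; rewrite A_coefE -(@bdiff_exp_eq0 _ a q 0) //.
by apply: eq_altdiff => t; rewrite addr0.
Qed.

Lemma A_coef_top q : A_coef R q q.+1 = (-1) ^+ q * q`!%:R.
Proof.
rewrite A_coefE /bdiff.
under eq_altdiff do rewrite addrC.
by rewrite altdiff_exp // eqxx.
Qed.

(** Periodicity merges the two boundary terms into differences of [(x + k) ^ s - x ^ s]. In its
    binomial expansion the term [j = 0] cancels, and [A_coef_eq0] cuts the range of [a]. *)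
Lemma power_sum_by_parts (h : nat -> nat -> R) s k :
  (forall n a, h n.+1 a.+1 = h n a.+1 + h n a) ->
  (forall a, h k a = h 0%N a) ->
  \sum_(n < k) n%:R ^+ s * h n 0%N =
  \sum_(1 <= j < s.+1) 'C(s, j)%:R * k%:R ^+ j *
    \sum_(1 <= a < (s - j + 1).+1) A_coef R (s - j) a * h 0%N a.
Proof.
move=> hE hk.
rewrite (@sum_by_parts _ h (fun x => x ^+ s) s.+1) => // [|c]; last first.
  by rewrite bdiff_exp_eq0.
rewrite -sumrB big_add1 /= big_mkord.
transitivity (\sum_(a < s.+1) \sum_(j < s) 'C(s, j.+1)%:R * k%:R ^+ j.+1 *
                 (A_coef R (s - j.+1) a.+1 * h 0%N a.+1)).
  apply: eq_bigr => a _; rewrite hk -mulrBl.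
  have -> : bdiff a (fun x : R => (x + k%:R) ^+ s) =
      \sum_(j < s.+1) ('C(s, j)%:R * k%:R ^+ j) * A_coef R (s - j) a.+1.
    under eq_bigr do rewrite A_coefE -altdiffZ.
    rewrite -altdiff_sum; apply: eq_altdiff => t.
    rewrite exprDn; apply: eq_bigr => j _.
    by rewrite -mulr_natl; ring.
  rewrite big_ord_recl /= bin0 expr0 subn0 A_coefE mul1r mul1r addrAC subrr add0r.
  by rewrite mulr_suml; apply: eq_bigr => j _; rewrite mulrA.
rewrite exchange_big; apply: eq_bigr => j _; rewrite -mulr_sumr; congr (_ * _).
rewrite big_add1 /= -(big_mkord xpredT (fun a => A_coef R (s - j.+1) a.+1 * h 0%N a.+1)).
have le : (s - j.+1 + 1 <= s.+1)%N by lia.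
rewrite (@big_cat_nat _ _ _ (s - j.+1 + 1)) //= -[RHS]addr0; congr (_ + _).
rewrite big_nat big1 // => a /andP[la _].
by rewrite A_coef_eq0 ?mul0r //; lia.
Qed.

End PowerSums.

(** * Bernoulli polynomials: difference equation and multiplication theorem *)

Section BernoulliPolynomials.
Variable R : numFieldType.
Implicit Types (p : {poly R}) (n : nat) (x : R).

Lemma poly_eq0_deriv p : p^`() = 0 -> p.[0] = 0 -> p = 0.
Proof.
move=> dp0 p0; apply/polyP => -[|i]; rewrite coef0; first by rewrite -horner_coef0.
have /eqP := congr1 (fun q : {poly R} => q`_i) dp0.
by rewrite coef_deriv coef0 mulrn_eq0 /= => /eqP.
Qed.

(** The polynomial [p - p(0)] vanishes at as many distinct integers as its size, so it is zero. *)
Lemma poly_periodic_const p : (forall x, p.[x + 1] = p.[x]) -> p = (p.[0])%:P.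
Proof.
move=> per; apply/eqP; rewrite -subr_eq0; apply/eqP.
set q := p - _; pose s := [seq i%:R : R | i <- iota 0 (size q)].
apply: (@roots_geq_poly_eq0 _ q s).
- apply/allP => _ /mapP[i _ ->]; rewrite /root !hornerE subr_eq0; apply/eqP.
  by elim: i => // i IH; rewrite mulrSr per.
- rewrite map_inj_uniq ?iota_uniq // => i j /eqP.
  by rewrite eqr_nat => /eqP.
- by rewrite size_map size_iota.
Qed.

Lemma deriv_sum (I : Type) (s : seq I) (P : pred I) (F : I -> {poly R}) :
  (\sum_(i <- s | P i) F i)^`() = \sum_(i <- s | P i) (F i)^`().
Proof. exact: raddf_sum. Qed.

Definition bernoulli_poly n : {poly R} :=
  \sum_(q < n.+1) ('C(n, q)%:R * bernoulli_number R q) *: 'X^(n - q).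

Lemma horner_bernoulli_poly n x : (bernoulli_poly n).[x] =
  \sum_(q < n.+1) 'C(n, q)%:R * bernoulli_number R q * x ^+ (n - q).
Proof. by rewrite horner_sum; apply: eq_bigr => q _; rewrite !hornerE. Qed.

Lemma bernoulli_poly_at0 n : (bernoulli_poly n).[0] = bernoulli_number R n.
Proof.
rewrite horner_bernoulli_poly big_ord_recr /= subnn binn mulr1 mul1r.
rewrite big1 ?add0r // => q _.
by rewrite expr0n subn_eq0 leqNgt ltn_ord mulr0.
Qed.

Lemma bernoulli_poly_at1 n :
  (bernoulli_poly n.+1).[1] = bernoulli_number R n.+1 + (n == 0%N)%:R.
Proof.
rewrite horner_bernoulli_poly big_ord_recr /= binn subnn mulr1 mul1r addrC.
rewrite -bernoulli_number_rec; congr (_ + _).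
by apply: eq_bigr => q _; rewrite expr1n mulr1.
Qed.

Lemma deriv_bernoulli_poly n :
  (bernoulli_poly n.+1)^`() = n.+1%:R *: bernoulli_poly n.
Proof.
rewrite /bernoulli_poly deriv_sum big_ord_recr /= subnn expr0 derivZ.
rewrite -polyC1 derivC scaler0 addr0 scaler_sumr; apply: eq_bigr => q _.
have qn : (q <= n)%N by rewrite -ltnS.
rewrite derivZ derivXn subSn //= -scaler_nat !scalerA; congr (_ *: _).
rewrite mulrAC -natrM mulrA -natrM; congr (_%:R * _).
by rewrite mulnC -(subSn qn) -mul_bin_down.
Qed.

(** The defect [Q n] of the identity vanishes at [0], and the derivative of [Q (n+1)] is
    [(n + 2) Q n], so induction on [n] gives [Q n = 0]. *)
Lemma bernoulli_poly_shift n x : (bernoulli_poly n.+1).[x + 1] =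
  (bernoulli_poly n.+1).[x] + n.+1%:R * x ^+ n.
Proof.
pose Q m := bernoulli_poly m.+1 \Po ('X + 1%:P) - bernoulli_poly m.+1
            - m.+1%:R *: 'X^m.
suff Q0 : Q n = 0.
  have := congr1 (fun p : {poly R} => p.[x]) Q0.
  rewrite /Q !hornerE horner_comp !hornerE => /eqP.
  by rewrite subr_eq0 subr_eq => /eqP ->; rewrite addrC.
elim: n => [|n IH]; apply: poly_eq0_deriv.
- rewrite /Q !derivB deriv_comp !derivZ deriv_bernoulli_poly derivXn mulr0n.
  rewrite scaler0 subr0 derivD derivX derivC addr0 mulr1.
  rewrite /bernoulli_poly big_ord1 /= subnn expr0 bin0 mulr1.
  by rewrite ?alg_polyC comp_polyC subrr.
- rewrite /Q !hornerE horner_comp !hornerE bernoulli_poly_at0.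
  by rewrite ?add0r bernoulli_poly_at1 /= addrAC addrK subrr.
- rewrite /Q !derivB deriv_comp !derivZ !deriv_bernoulli_poly derivXn.
  rewrite derivD derivX derivC addr0 mulr1 linearZ /= -scaler_nat -!scalerBr.
  by rewrite -/(Q n) IH scaler0.
- rewrite /Q !hornerE horner_comp !hornerE bernoulli_poly_at0.
  by rewrite ?add0r bernoulli_poly_at1 expr0n /= mulr0 !subr0 addr0 subrr.
Qed.

(** The defect [D (n+1)] has derivative [(n + 1) D n]. By the difference equation it has period 1,
    hence is constant, so [D n = 0] with no constant of integration to compute. *)
Lemma bernoulli_poly_mul (d n : nat) x : (0 < d)%N ->
  d%:R ^+ n * (\sum_(l < d) (bernoulli_poly n).[(x + l%:R) / d%:R]) =
  d%:R * (bernoulli_poly n).[x].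
Proof.
move=> d0; have dn0 : d%:R != 0 :> R by rewrite pnatr_eq0 -lt0n.
pose q l : {poly R} := d%:R^-1 *: ('X + l%:R%:P).
pose M m := \sum_(l < d) (bernoulli_poly m \Po q l).
pose D m := d%:R ^+ m *: M m - d%:R *: bernoulli_poly m.
have ME m y : (M m).[y] = \sum_(l < d) (bernoulli_poly m).[(y + l%:R) / d%:R].
  rewrite /M horner_sum; apply: eq_bigr => l _.
  by rewrite horner_comp !hornerE mulrC.
suff D0 : D n = 0.
  have /eqP := congr1 (fun p : {poly R} => p.[x]) D0.
  by rewrite /D !hornerE subr_eq0 -ME => /eqP.
have dD : (D n.+1)^`() = n.+1%:R *: D n.
  rewrite /D derivB !derivZ deriv_bernoulli_poly /M deriv_sum.
  rewrite scalerBr !scalerA; congr (_ - _ *: _); last by rewrite mulrC.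
  rewrite !scaler_sumr; apply: eq_bigr => l _.
  rewrite deriv_comp deriv_bernoulli_poly derivZ derivD derivX derivC addr0.
  rewrite linearZ /= -scalerAl -scalerAr mulr1 !scalerA; congr (_ *: _).
  by rewrite exprSr mulrAC mulfK // mulrC.
have cD : D n.+1 = ((D n.+1).[0])%:P.
  apply: poly_periodic_const => y; rewrite /D !hornerE !ME.
  pose g l := (bernoulli_poly n.+1).[(y + l%:R) / d%:R].
  have -> : \sum_(l < d) (bernoulli_poly n.+1).[(y + 1 + l%:R) / d%:R] =
      \sum_(l < d) g l + n.+1%:R * (y / d%:R) ^+ n.
    have -> : \sum_(l < d) (bernoulli_poly n.+1).[(y + 1 + l%:R) / d%:R] =
        \sum_(l < d) g l.+1.
      by apply: eq_bigr => l _; rewrite /g mulrS addrA.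
    (* Only the ends [l = d] and [l = 0] survive, and their arguments differ by 1. *)
    have := telescope_sumr g (leq0n d).
    rewrite sumrB !big_mkord => /eqP; rewrite subr_eq => /eqP ->.
    rewrite addrC; congr (_ + _).
    by rewrite /g mulrDl divff // bernoulli_poly_shift addr0 addrAC subrr add0r.
  rewrite bernoulli_poly_shift /g expr_div_n exprS; field; rewrite ?expf_neq0 ?dn0 //.
move: dD; rewrite cD derivC => /esym/eqP.
by rewrite scaler_eq0 pnatr_eq0 /= => /eqP.
Qed.

End BernoulliPolynomials.

(** * Chebyshev polynomials *)

Section ChebyshevPolynomials.
Variable R : realType.
Implicit Types (n c : nat) (y t : R).

(** The Chebyshev polynomial of the second kind at [y / 2]. When [2 c > n] the binomial coefficient
    is zero, so the truncated exponent is harmless. *)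
Definition chebyU n y : R :=
  \sum_(c < n.+1) (-1) ^+ c * 'C(n - c, c)%:R * y ^+ (n - 2 * c).

Lemma chebyU0 y : chebyU 0 y = 1.
Proof. by rewrite /chebyU big_ord1 /= bin0 !mul1r. Qed.

Lemma chebyU1 y : chebyU 1 y = y.
Proof.
by rewrite /chebyU big_ord_recr big_ord1 /= bin0 bin_small // mulr0 mul0r addr0 !mul1r.
Qed.

Lemma chebyU_rec n y : chebyU n.+2 y = y * chebyU n.+1 y - chebyU n y.
Proof.
rewrite /chebyU big_ord_recl [in X in _ = X - _]big_ord_recl /=.
rewrite !subn0 !bin0 !mul1r mulrDr -exprS -addrA; congr (_ + _).
rewrite big_ord_recr /=.
rewrite /bump /= !add1n subnn bin0n mulr0 mul0r addr0.
rewrite mulr_sumr -sumrB; apply: eq_bigr => c _.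
rewrite /bump /= !add1n (subSS c n.+1) (subSS c n).
have cn : (c <= n)%N by rewrite -ltnS.
rewrite subSn // binS natrD.
have -> : (n.+2 - 2 * c.+1 = n - 2 * c)%N by lia.
(* For [2 c >= n] the exponent of the first sum truncates, but there its coefficient vanishes. *)
have [lt|ge] := ltnP (2 * c) n.
  have -> : (n - 2 * c = (n.+1 - 2 * c.+1).+1)%N by lia.
  move: (n.+1 - _)%N => e; rewrite !exprS.
  move: ('C(n - c, c.+1)%:R) ('C(n - c, c)%:R) => u v; ring.
have -> : 'C(n - c, c.+1) = 0%N by rewrite bin_small //; move: ge cn; clear; lia.
by rewrite exprS; move: ('C(n - c, c)%:R) => v; ring.
Qed.

Lemma chebyU_at2 n : chebyU n 2 = n.+1%:R.
Proof.
suff [] : chebyU n 2 = n.+1%:R /\ chebyU n.+1 2 = n.+2%:R by [].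
elim: n => [|n [IH1 IH2]]; first by rewrite chebyU0 chebyU1.
by split=> //; rewrite chebyU_rec IH1 IH2 (mulrSr 1 n.+2) (mulrSr 1 n.+1); ring.
Qed.

Lemma sin_chebyU n t : sin (n.+1%:R * t) = sin t * chebyU n (2 * cos t).
Proof.
suff [] : sin (n.+1%:R * t) = sin t * chebyU n (2 * cos t) /\
          sin (n.+2%:R * t) = sin t * chebyU n.+1 (2 * cos t) by [].
elim: n => [|n [IH1 IH2]].
  rewrite chebyU0 chebyU1 mul1r mulr1; split=> //.
  by rewrite mulr_natl sin_mulr2n; ring.
split=> //; rewrite chebyU_rec mulrBr -IH1 mulrCA -IH2.
have -> : n.+3%:R * t = n.+2%:R * t + t by rewrite (mulrSr 1 n.+2); ring.
have -> : n.+1%:R * t = n.+2%:R * t - t by rewrite (mulrSr 1 n.+1); ring.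
by rewrite sinD sinB; ring.
Qed.

(** After multiplication by [sin t] this is [2 sin t cos ((n+2) t) = sin ((n+3) t) - sin ((n+1)
    t)]. *)
Lemma cos_chebyU n t : sin t != 0 ->
  2 * cos (n.+2%:R * t) = chebyU n.+2 (2 * cos t) - chebyU n (2 * cos t).
Proof.
move=> st; apply: (mulfI st); rewrite mulrBr -!sin_chebyU.
have -> : n.+3%:R * t = n.+2%:R * t + t by rewrite (mulrSr 1 n.+2); ring.
have -> : n.+1%:R * t = n.+2%:R * t - t by rewrite (mulrSr 1 n.+1); ring.
by rewrite sinD sinB; ring.
Qed.

Lemma fact_neq0 n : n`!%:R != 0 :> R.
Proof. by rewrite pnatr_eq0 -lt0n fact_gt0. Qed.

Lemma chebyU_fact n y : chebyU n y =
  \sum_(c < n./2.+1) (-1) ^+ c * (n - c)`!%:R / (c`!%:R * (n - 2 * c)`!%:R)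
                     * y ^+ (n - 2 * c).
Proof.
pose F c : R := (-1) ^+ c * 'C(n - c, c)%:R * y ^+ (n - 2 * c).
pose G c : R := (-1) ^+ c * (n - c)`!%:R / (c`!%:R * (n - 2 * c)`!%:R)
                  * y ^+ (n - 2 * c).
rewrite /chebyU -(big_mkord xpredT F) -(big_mkord xpredT G).
rewrite (@big_cat_nat _ _ _ n./2.+1) //=; last by lia.
rewrite addrC big_nat big1 ?add0r => [|c /andP[nc _]]; last first.
  by rewrite /F bin_small ?mulr0 ?mul0r //; lia.
apply: eq_big_nat => c /andP[_ cn]; congr (_ * _).
rewrite -mulrA; congr (_ * _).
have le : (c <= n - c)%N by lia.
have := congr1 (fun m => m%:R : R) (bin_fact le).
have -> : (n - c - c = n - 2 * c)%N by lia.
by rewrite /= !natrM => <-; field; rewrite !fact_neq0.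
Qed.

Lemma chebyU_sub n y : chebyU n.+2 y - chebyU n y =
  \sum_(c < n.+2./2.+1) (-1) ^+ c * n.+2%:R * (n.+2 - c - 1)`!%:R
     / (c`!%:R * (n.+2 - 2 * c)`!%:R) * y ^+ (n.+2 - 2 * c).
Proof.
rewrite !chebyU_fact /= big_ord_recl [RHS]big_ord_recl /= -addrA; congr (_ + _).
  congr (_ * _); rewrite !subn0 !mul1r subn1 /= !factS !natrM.
  by field; rewrite fact_neq0 nat1r -natrD !pnatr_eq0.
rewrite -sumrB; apply: eq_bigr => c _; rewrite /bump /= !add1n.
have cn : (2 * c <= n)%N by have := ltn_ord c; lia.
have -> : (n.+2 - c.+1 = (n - c).+1)%N by lia.
have -> : ((n - c).+1 - 1 = n - c)%N by lia.
have -> : (n.+2 - 2 * c.+1 = n - 2 * c)%N by lia.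
(* Over the common factor [(n - c)! / ((c + 1)! (n - 2 c)!)] the two terms contribute [n - c + 1]
   and [c + 1]. *)
have -> : n.+2%:R = (n - c).+1%:R + c.+1%:R :> R by rewrite -natrD; congr (_%:R); lia.
rewrite !factS !natrM exprS; field.
by rewrite !fact_neq0 nat1r pnatr_eq0.
Qed.

End ChebyshevPolynomials.

(** * Powers of [1 / (z - 1)] and even powers of the cosecant *)

Section CosecantSequences.
Variable R : realType.
Implicit Types (t : R) (n a b c : nat).

(* The real part of [z ^+ n / (z - 1) ^+ a] for [z = exp (2 i t)]. *)
Definition recot t n a : R :=
  cos ((2 * n%:R - a%:R) * t - a%:R * (pi / 2)) / (2 * sin t) ^+ a.

Lemma recot0 t n : recot t n 0 = cos (2 * n%:R * t).
Proof. by rewrite /recot subr0 mul0r subr0 expr0 divr1. Qed.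

(** Real part of [z ^ (n+1) = z ^ n + z ^ n (z - 1)] divided by [(z - 1) ^ (a+1)]. *)
Lemma recot_rec t n a : sin t != 0 ->
  recot t n.+1 a.+1 = recot t n a.+1 + recot t n a.
Proof.
move=> st; rewrite /recot.
set u := (2 * n%:R - a%:R) * t - a%:R * (pi / 2).
have -> : (2 * n.+1%:R - a.+1%:R) * t - a.+1%:R * (pi / 2) = u + t - pi / 2.
  by rewrite /u !mulrSr; ring.
have -> : (2 * n%:R - a.+1%:R) * t - a.+1%:R * (pi / 2) = u - t - pi / 2.
  by rewrite /u !mulrSr; ring.
clearbody u.
rewrite !cosBpihalf sinD sinB exprS.
field.
by rewrite st expf_neq0 // mulf_neq0.
Qed.

Lemma cosDnpi n t : cos (t + n%:R * pi) = (-1) ^+ n * cos t.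
Proof.
elim: n t => [|n IH] t; first by rewrite mul0r addr0 mul1r.
have -> : t + n.+1%:R * pi = t + n%:R * pi + pi by rewrite mulrSr; ring.
by rewrite cosDpi IH exprS; ring.
Qed.

(** Here [z ^ k = 1]: the angle grows by [2 m pi]. *)
Lemma recot_periodic k m a : (0 < k)%N ->
  recot (pi * m%:R / k%:R) k a = recot (pi * m%:R / k%:R : R) 0 a.
Proof.
move=> k0; have kn0 : k%:R != 0 :> R by rewrite pnatr_eq0 -lt0n.
rewrite /recot; congr (_ / _); set t := pi * _ / _.
have -> : (2 * k%:R - a%:R) * t - a%:R * (pi / 2) =
   (2 * 0%:R - a%:R) * t - a%:R * (pi / 2) + (2 * m)%:R * pi.
  by rewrite /t natrM; field.
by rewrite cosDnpi exprM sqrrN !expr1n mul1r.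
Qed.

(** Binomial expansion of [cos t ^ (2 (h - c)) = (1 - sin t ^ 2) ^ (h - c)]. *)
Lemma sum_recip_sin t h c : sin t != 0 -> (c <= h)%N ->
  \sum_(0 <= d < (h - c).+1)
    (-1) ^+ d * 'C(h - c, d)%:R * (1 / sin t ^+ (2 * h - 2 * d)) =
  cos t ^+ (2 * h - 2 * c) / sin t ^+ (2 * h).
Proof.
move=> st ch.
have -> : (2 * h - 2 * c = 2 * (h - c))%N by lia.
rewrite exprM cos2sin2 exprDn big_mkord mulr_suml; apply: eq_bigr => d _.
have -> : sin t ^+ (2 * h) = sin t ^+ (2 * h - 2 * d) * sin t ^+ (2 * d).
  by rewrite -exprD; congr (_ ^+ _); have := ltn_ord d; lia.
rewrite expr1n [(- (_ ^+ 2)) ^+ d]exprNn -exprM -mulr_natl; field.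
by rewrite !expf_neq0.
Qed.

Lemma recot_odd t b : recot t 0 (2 * b + 1) =
  (-1) ^+ b.+1 * sin ((2 * b).+1%:R * t) / (2 * sin t) ^+ (2 * b + 1).
Proof.
rewrite /recot mulr0 sub0r addn1; congr (_ / _).
rewrite -cosN opprB mulNr opprK.
have -> : (2 * b).+1%:R * (pi / 2) + (2 * b).+1%:R * t =
   (2 * b).+1%:R * t + pi / 2 + b%:R * pi by rewrite mulrSr natrM; field.
by rewrite cosDnpi cosDpihalf exprS; ring.
Qed.

Lemma recot_even t b : recot t 0 (2 * b) =
  (-1) ^+ b * cos ((2 * b)%:R * t) / (2 * sin t) ^+ (2 * b).
Proof.
rewrite /recot mulr0 sub0r; congr (_ / _).
rewrite -cosN opprB mulNr opprK addrC -cosDnpi; congr (cos (_ + _)).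
by rewrite natrM; field.
Qed.

(** Up to [E_factor], the coefficient of [cos t ^ (2 h - 2 c) / sin t ^ (2 h)] in [recot t 0 a],
    where [h = a./2]. *)
Definition cosec_coef a c : R :=
  (-1) ^+ (c + (a + 1)./2) * (a - c - 1)`!%:R
    / (2 ^+ (2 * c + 1) * c`!%:R * (2 * a./2 - 2 * c)`!%:R).

(** For odd [a] the factor [sin t] of [sin (a t)] lowers the denominator to an even power. For even
    [a] the numerator is half a difference of two [chebyU], which brings in the factor [a] of
    [E_factor]. Either way only even powers of [cos t] remain. *)
Lemma recot_cosec t a : sin t != 0 -> (0 < a)%N ->
  recot t 0 a = E_factor R a * \sum_(0 <= c < a./2.+1) cosec_coef a c *
    \sum_(0 <= d < (a./2 - c).+1)
      (-1) ^+ d * 'C(a./2 - c, d)%:R * (1 / sin t ^+ (2 * a./2 - 2 * d)).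
Proof.
move=> st a0.
under eq_big_nat => c /andP[_ ca] do rewrite sum_recip_sin //.
rewrite big_mkord /E_factor /cosec_coef.
have [b ab] : exists b, a = (2 * b + 1)%N \/ a = (2 * b.+1)%N.
  by exists (a.-1)./2; have := odd_double_half a.-1; case: (odd a.-1); lia.
case: ab => ->.
  rewrite recot_odd sin_chebyU chebyU_fact.
  have -> : odd (2 * b + 1) by lia.
  have -> : ((2 * b)./2 = b)%N by lia.
  have -> : ((2 * b + 1)./2 = b)%N by lia.
  have -> : ((2 * b + 1 + 1)./2 = b.+1)%N by lia.
  rewrite mul1r mulrCA mulr_sumr mulr_sumr mulr_suml; apply: eq_bigr => c _.
  have cb : (c <= b)%N by rewrite -ltnS.
  have -> : (2 * b + 1 - c - 1 = 2 * b - c)%N by lia.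
  have e1 : (2 * b + 1 = (2 * b - 2 * c) + (2 * c + 1))%N by lia.
  rewrite [in LHS]exprMn [in LHS]exprMn.
  have -> : 2 ^+ (2 * b + 1) = 2 ^+ (2 * b - 2 * c) * 2 ^+ (2 * c + 1) :> R.
    by rewrite -exprD -e1.
  rewrite [sin t ^+ (2 * b + 1)]exprD expr1 [(-1) ^+ (c + _)]exprD; field.
  by rewrite !fact_neq0 st !expf_neq0.
rewrite recot_even.
have -> : odd (2 * b.+1) = false by lia.
have -> : ((2 * b.+1)./2 = b.+1)%N by lia.
have -> : ((2 * b.+1 + 1)./2 = b.+1)%N by lia.
have e2 : cos ((2 * b.+1)%:R * t) =
    (chebyU (2 * b).+2 (2 * cos t) - chebyU (2 * b) (2 * cos t)) / 2.
  by rewrite -cos_chebyU // [RHS]mulrC mulKf //; congr (cos (_%:R * _)); lia.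
rewrite e2 chebyU_sub.
have -> : ((2 * b).+2 = 2 * b.+1)%N by lia.
have -> : ((2 * b.+1)./2 = b.+1)%N by lia.
rewrite mulr_suml !mulr_sumr mulr_suml; apply: eq_bigr => c _.
have cb : (c <= b.+1)%N by rewrite -ltnS.
rewrite [in LHS]exprMn [in LHS]exprMn.
have -> : 2 ^+ (2 * b.+1) = 2 ^+ (2 * b.+1 - 2 * c) * 2 ^+ (2 * c) :> R.
  by rewrite -exprD; congr (_ ^+ _); lia.
rewrite [2 ^+ (2 * c + 1)]exprD [(-1) ^+ (c + _)]exprD; field.
by rewrite !fact_neq0 !expf_neq0.
Qed.

(* The constant term of [cos (2 b t)] as a polynomial in [sin t] is its value at [t = 0]. *)
Lemma sum_cosec_coef b : (0 < b)%N ->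
  E_factor R (2 * b) * (\sum_(0 <= c < b.+1) cosec_coef (2 * b) c) =
  (-1) ^+ b / 2 ^+ (2 * b).
Proof.
case: b => // b _; rewrite big_mkord /E_factor /cosec_coef.
have -> : odd (2 * b.+1) = false by lia.
have -> : ((2 * b.+1)./2 = b.+1)%N by lia.
have -> : ((2 * b.+1 + 1)./2 = b.+1)%N by lia.
have := chebyU_sub (2 * b) (2 : R).
rewrite !chebyU_at2.
have -> : ((2 * b).+2./2 = b.+1)%N by lia.
have -> : (2 * b).+3%:R - (2 * b).+1%:R = 2 :> R.
  by rewrite (mulrSr 1 (2 * b).+2) (mulrSr 1 (2 * b).+1); ring.
have -> : ((2 * b).+2 = 2 * b.+1)%N by lia.
(* The difference of the two [chebyU] at [y = 2] equals 2; the factor rescales it to the claimed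
   value. *)
move=> /(congr1 (fun x => (-1) ^+ b.+1 / 2 ^+ (2 * b.+1) / 2 * x)).
rewrite divfK // => ->; rewrite !mulr_sumr; apply: eq_bigr => c _.
have cb : (c <= b.+1)%N by rewrite -ltnS.
have -> : 2 ^+ (2 * b.+1) = 2 ^+ (2 * b.+1 - 2 * c) * 2 ^+ (2 * c) :> R.
  by rewrite -exprD; congr (_ ^+ _); lia.
rewrite [2 ^+ (2 * c + 1)]exprD [(-1) ^+ (c + _)]exprD; field.
by rewrite !fact_neq0 !expf_neq0.
Qed.

End CosecantSequences.

(** * Orthogonality, scaling and the sieve to the Jordan totient *)

Section JordanTotient.
Variable R : realType.
Implicit Types (r k m n d p : nat).

Lemma sin_pi_frac_neq0 m k : (0 < m < k)%N -> sin (pi * m%:R / k%:R : R) != 0.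
Proof.
move=> /andP[m0 mk]; rewrite gt_eqF //; apply: sin_gt0_pi.
have k0 : 0 < k%:R :> R by rewrite ltr0n (leq_trans _ mk).
apply/andP; split; first by rewrite divr_gt0 // mulr_gt0 ?pi_gt0 ?ltr0n.
by rewrite ltr_pdivrMr // ltr_pM2l ?pi_gt0 // ltr_nat.
Qed.

Lemma sum_cos_frac n k : (n < k)%N ->
  \sum_(m < k) cos (2 * n%:R * (pi * m%:R / k%:R)) = (k%:R : R) *+ (n == 0%N).
Proof.
case: n => [|n] nk.
  under eq_bigr do rewrite mulr0 mul0r cos0.
  by rewrite sumr_const card_ord.
pose t : R := pi * n.+1%:R / k%:R.
have st : sin t != 0 by rewrite sin_pi_frac_neq0.
(* With the roles of [m] and [n] exchanged, [recot t m 1] is an antidifference of [cos (2 m t)], and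
   it has period [k] in [m]. *)
transitivity (\sum_(0 <= m < k) (recot t m.+1 1 - recot t m 1)).
  rewrite big_mkord; apply: eq_bigr => m _.
  rewrite recot_rec // addrAC subrr add0r recot0 /t; congr cos.
  by rewrite !mulrA; congr (_ * _); ring.
by rewrite telescope_sumr // recot_periodic ?subrr //; apply: leq_trans nk.
Qed.

(** The normalisation [k ^ (r-1)], written as a quotient, makes the value invariant under a common
    positive scaling of [k] and [m]. *)
Definition cos_bernoulli r k m : R :=
  k%:R ^+ r / k%:R *
  \sum_(n < k) (bernoulli_poly R r).[n%:R / k%:R]
               * cos (2 * n%:R * (pi * m%:R / k%:R)).

(** Write the summation index as [n + i k] with [n < k] and [i < d]: the cosine does not depend on
    [i], and the sum over [i] is the one in the multiplication theorem. *)
Lemma cos_bernoulli_scale r d k m : (0 < d)%N -> (0 < k)%N ->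
  cos_bernoulli r (d * k) (d * m) = cos_bernoulli r k m.
Proof.
move=> d0 k0.
have dn0 : d%:R != 0 :> R by rewrite pnatr_eq0 -lt0n.
have kn0 : k%:R != 0 :> R by rewrite pnatr_eq0 -lt0n.
rewrite /cos_bernoulli; pose t : R := pi * m%:R / k%:R.
have -> : pi * (d * m)%:R / (d * k)%:R = t by rewrite /t !natrM; field; rewrite ?dn0 ?kn0 //.
pose F n := (bernoulli_poly R r).[n%:R / (d * k)%:R] * cos (2 * n%:R * t).
rewrite -(big_mkord xpredT F) big_nat_mul.
have -> : \sum_(0 <= i < d) \sum_(i * k <= j < i.+1 * k) F j =
   \sum_(i < d) \sum_(n < k) (bernoulli_poly R r).[(n%:R / k%:R + i%:R) / d%:R]
      * cos (2 * n%:R * t).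
  rewrite big_mkord; apply: eq_bigr => i _.
  rewrite -[X in \sum_(X <= _ < _) _]add0n big_addn.
  have -> : (i.+1 * k - i * k = k)%N by rewrite mulSn addnK.
  rewrite big_mkord; apply: eq_bigr => n _; rewrite /F; congr (_.[_] * _).
    by rewrite natrD !natrM; field; rewrite ?dn0 ?kn0 //.
  have -> : 2 * (n + i * k)%:R * t = 2 * n%:R * t + (2 * (m * i))%:R * pi.
    by rewrite /t natrD !natrM; field.
  by rewrite cosDnpi exprM sqrrN !expr1n mul1r.
rewrite exchange_big /=.
under eq_bigr do rewrite -mulr_suml.
rewrite natrM exprMn.
have -> : d%:R ^+ r * k%:R ^+ r / (d%:R * k%:R) =
   k%:R ^+ r / k%:R * (d%:R ^+ r / d%:R) :> R by field; rewrite ?dn0 ?kn0 //.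
rewrite -[LHS]mulrA; congr (_ * _); rewrite mulr_sumr; apply: eq_bigr => n _.
rewrite [LHS]mulrA; congr (_ * _); rewrite mulrAC bernoulli_poly_mul // mulrC.
by rewrite mulKf.
Qed.

(** Orthogonality of the cosines leaves only [n = 0], where the Bernoulli polynomial is [B_r]. *)
Lemma sum_cos_bernoulli r k : (0 < k)%N ->
  \sum_(m < k) cos_bernoulli r k m = bernoulli_number R r * k%:R ^+ r.
Proof.
case: k => // k _.
rewrite -mulr_sumr exchange_big /=.
under eq_bigr => n _ do rewrite -mulr_sumr sum_cos_frac //.
rewrite big_ord_recl big1 => [|n _]; last by rewrite mulr0n mulr0.
rewrite mul0r bernoulli_poly_at0 addr0 mulr1n; field.
by rewrite nat1r pnatr_eq0.
Qed.

Lemma sum_dvdn (V : nmodType) p k (P : pred nat) (F : nat -> V) : (0 < p)%N ->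
  \sum_(m < p * k | P m && (p %| m)%N) F m = \sum_(m < k | P (p * m)%N) F (p * m)%N.
Proof.
move=> p0; rewrite big_mkcond [RHS]big_mkcond /= mulnC.
pose G m := if P m && (p %| m)%N then F m else 0.
rewrite -(big_mkord xpredT G) big_nat_mul big_mkord; apply: eq_bigr => i _.
rewrite -[X in \sum_(X <= _ < _) _]add0n big_addn.
have -> : (i.+1 * p - i * p = p)%N by rewrite mulSn addnK.
rewrite big_ltn // big_nat big1 ?addr0 /G => [|j /andP[j0 jp]].
  by rewrite add0n dvdn_mull // andbT mulnC.
by rewrite dvdn_addl ?dvdn_mull // gtnNdvd // andbF.
Qed.

(* Each prime [p] of [s] removes the multiples of [p], a scaled copy of the sum for [k / p]. *)
Lemma sum_cos_bernoulli_sieve r (s : seq nat) k : (0 < k)%N ->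
  uniq s -> all prime s -> all (dvdn^~ k) s ->
  \sum_(m < k | all (fun p => ~~ (p %| m)%N) s) cos_bernoulli r k m =
  bernoulli_number R r * (k%:R ^+ r * \prod_(p <- s) (1 - 1 / p%:R ^+ r)).
Proof.
elim: s k => [|p s IH] k k0 /=.
  by rewrite big_nil mulr1 => *; apply: sum_cos_bernoulli.
move=> /andP[ps us] /andP[pp sp] /andP[/dvdnP[k' ek] sk].
rewrite mulnC in ek; rewrite {}ek in k0 sk *.
have k'0 : (0 < k')%N by move: k0; rewrite muln_gt0 => /andP[].
have p0 : (0 < p)%N by exact: prime_gt0.
have pn0 : p%:R != 0 :> R by rewrite pnatr_eq0 -lt0n.
pose Q m := all (fun q => ~~ (q %| m)%N) s.
have ndvd q m : q \in s -> (q %| p * m)%N = (q %| m)%N.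
  move=> qs; have qp := allP sp q qs.
  rewrite Euclid_dvdM // dvdn_prime2 //.
  by case: eqP => // qep; rewrite -qep qs in ps.
(* The sum sieved by [s] is split by divisibility by [p]. The multiples of [p] rescale to the sum
   for [k'], also known by induction, and subtraction leaves the wanted part. *)
have := IH _ k0 us sp sk; rewrite (bigID (fun m : 'I__ => (p %| m)%N)) /=.
rewrite (@sum_dvdn _ p k' Q) //.
have -> : \sum_(m < k' | Q (p * m)%N) cos_bernoulli r (p * k') (p * m) =
    \sum_(m < k' | Q m) cos_bernoulli r k' m.
  apply: eq_big => [m|m _]; last by rewrite cos_bernoulli_scale.
  by apply: eq_in_all => q qs; rewrite ndvd.
rewrite IH //; last first.
  by apply/allP => q qs; rewrite -ndvd //; exact: (allP sk).
move=> /(canRL (addKr _)).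
under eq_bigl do rewrite andbC.
move=> ->; rewrite big_cons natrM exprMn; field.
by rewrite expf_neq0.
Qed.

Lemma coprime_all_primes m k : (0 < k)%N ->
  coprime m k = all (fun p => ~~ (p %| m)%N) (primes k).
Proof.
move=> k0; apply/idP/allP => [cmk p|h].
  rewrite mem_primes => /and3P[pp _ pk]; apply/negP => pm.
  have : (p %| gcdn m k)%N by rewrite dvdn_gcd pm.
  by rewrite (eqP cmk) dvdn1 => /eqP p1; rewrite p1 in pp.
apply: contraT => ncop.
have g1 : (1 < gcdn m k)%N.
  by rewrite ltn_neqAle eq_sym ncop gcdn_gt0 k0 orbT.
have /h : pdiv (gcdn m k) \in primes k.
  by rewrite mem_primes pdiv_prime // k0 (dvdn_trans (pdiv_dvd _)) ?dvdn_gcdr.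
by rewrite (dvdn_trans (pdiv_dvd _)) ?dvdn_gcdl.
Qed.

Lemma sum_coprime_cos_bernoulli r k : (1 < k)%N ->
  \sum_(1 <= m < k.+1 | coprime m k) cos_bernoulli r k m =
  bernoulli_number R r * jordan_totient R r k.
Proof.
move=> k1; have k0 := ltnW k1.
rewrite /jordan_totient -sum_cos_bernoulli_sieve ?primes_uniq //; last 2 first.
- by apply/allP => p; rewrite mem_primes => /and3P[].
- by apply/allP => p; rewrite mem_primes => /and3P[].
rewrite big_mkcond big_nat_recr //=.
under [RHS]eq_bigl do rewrite -coprime_all_primes //.
rewrite -(big_mkord (coprime^~ k) (cos_bernoulli r k)) [RHS]big_ltn_cond //.
(* The two ranges differ in the indices [0] and [k], neither prime to [k] since [k > 1]. *)
rewrite /coprime gcd0n gcdnn gtn_eqF // addr0 -big_mkcond.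
by [].
Qed.

End JordanTotient.

(** * The outer triple sum as a linear functional *)

Section BernoulliSums.
Variable R : realType.
Implicit Types (r k m a : nat) (f g : nat -> R).

(** The sums over [q], [j] and [a] of the theorem with the inner expression left open as [f];
    linearity in [f] lets the sum over [m] pass inside. *)
Definition bernoulli_sum r k f : R :=
  \sum_(0 <= q < r.+1)
    'C(r, q)%:R * (bernoulli_number R q / k%:R ^+ (r - q)) *
    \sum_(1 <= j < (r - q).+1) 'C(r - q, j)%:R * k%:R ^+ j *
      \sum_(1 <= a < (r - q - j + 1).+1) A_coef R (r - q - j) a * f a.

Lemma eq_bernoulli_sum r k f g :
  (forall a, (0 < a <= r)%N -> f a = g a) ->
  bernoulli_sum r k f = bernoulli_sum r k g.
Proof.
move=> fg; apply: eq_bigr => q _; congr (_ * _).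
apply: eq_big_nat => j /andP[j0 jr]; congr (_ * _).
apply: eq_big_nat => a /andP[a0 ar]; congr (_ * _).
by apply: fg; lia.
Qed.

Lemma bernoulli_sumD r k f g :
  bernoulli_sum r k (fun a => f a + g a) = bernoulli_sum r k f + bernoulli_sum r k g.
Proof.
rewrite -big_split; apply: eq_bigr => q _ /=; rewrite -mulrDr; congr (_ * _).
rewrite -big_split; apply: eq_bigr => j _ /=; rewrite -mulrDr; congr (_ * _).
by rewrite -big_split; apply: eq_bigr => a _ /=; rewrite -mulrDr.
Qed.

Lemma bernoulli_sumZ r k (x : R) f :
  bernoulli_sum r k (fun a => x * f a) = x * bernoulli_sum r k f.
Proof.
rewrite /bernoulli_sum mulr_sumr; apply: eq_bigr => q _; rewrite [RHS]mulrCA; congr (_ * _).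
rewrite mulr_sumr; apply: eq_bigr => j _; rewrite [RHS]mulrCA; congr (_ * _).
by rewrite mulr_sumr; apply: eq_bigr => a _; rewrite [RHS]mulrCA.
Qed.

Lemma bernoulli_sum_sum r k (I : Type) (s : seq I) (P : pred I) (f : I -> nat -> R) :
  bernoulli_sum r k (fun a => \sum_(i <- s | P i) f i a) =
  \sum_(i <- s | P i) bernoulli_sum r k (f i).
Proof.
rewrite exchange_big /=; apply: eq_bigr => q _; rewrite -mulr_sumr; congr (_ * _).
rewrite exchange_big /=; apply: eq_bigr => j _; rewrite -mulr_sumr; congr (_ * _).
by rewrite exchange_big /=; apply: eq_bigr => a _; rewrite -mulr_sumr.
Qed.

(* Only [q = 0], [j = 1] reaches the index [a = r]. *)
Lemma bernoulli_sum_top r k : (0 < r)%N ->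
  bernoulli_sum r k (fun a => (a == r)%:R) = (-1) ^+ r.-1 * r`!%:R * (k%:R / k%:R ^+ r).
Proof.
case: r => // r _; rewrite /bernoulli_sum big_ltn // addrC big_nat big1.
  rewrite add0r subn0 big_ltn // [X in _ * X]addrC big_nat big1.
    rewrite add0r subn1 addn1 /= big_nat_recr //= big_nat big1 => [|a /andP[_ ar]].
      rewrite add0r eqxx mulr1 A_coef_top bin0 bin1 factS natrM.
      by rewrite bernoulli_number0; ring.
    by rewrite ltn_eqF // mulr0.
  move=> j /andP[j1 jr]; rewrite big_nat big1 ?mulr0 // => a /andP[_ ar].
  by rewrite ltn_eqF ?mulr0 //; lia.
move=> q /andP[q1 qr]; rewrite [X in _ * X]big_nat big1 ?mulr0 // => j /andP[j1 jr].
rewrite big_nat big1 ?mulr0 // => a /andP[_ ar].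
by rewrite ltn_eqF ?mulr0 //; lia.
Qed.

(** Expand the Bernoulli polynomial in powers of [n] and sum each power by parts against [recot];
    [0 < m < k] keeps the sine nonzero. *)
Lemma cos_bernoulliE r k m : (0 < m < k)%N ->
  cos_bernoulli R r k m =
  k%:R ^+ r / k%:R * bernoulli_sum r k (recot (pi * m%:R / k%:R) 0).
Proof.
move=> mk; have k0 : (0 < k)%N by case/andP: mk => _; apply: leq_trans.
have kn0 : k%:R != 0 :> R by rewrite pnatr_eq0 -lt0n.
have st := @sin_pi_frac_neq0 R _ _ mk.
rewrite /cos_bernoulli; congr (_ * _); set t := pi * _ / _ in st *.
under eq_bigr do rewrite horner_bernoulli_poly mulr_suml.
rewrite exchange_big /bernoulli_sum big_mkord; apply: eq_bigr => q _.
rewrite -(@power_sum_by_parts R (recot t)); last 2 first.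
- by move=> n a; apply: recot_rec.
- by move=> a; apply: recot_periodic.
rewrite mulr_sumr; apply: eq_bigr => n _; rewrite recot0 expr_div_n; field.
by rewrite expf_neq0.
Qed.

Lemma sum_recot_cosec k a : (1 < k)%N -> (0 < a)%N ->
  \sum_(1 <= m < k.+1 | coprime m k) recot (pi * m%:R / k%:R) 0 a =
  E_factor R a * \sum_(0 <= c < a./2.+1) cosec_coef R a c *
    \sum_(0 <= d < (a./2 - c).+1)
      (-1) ^+ d * 'C(a./2 - c, d)%:R * SIN R k (2 * a./2 - 2 * d).
Proof.
move=> k1 a0.
transitivity (\sum_(1 <= m < k.+1 | coprime m k)
   E_factor R a * \sum_(0 <= c < a./2.+1) cosec_coef R a c *
    \sum_(0 <= d < (a./2 - c).+1) (-1) ^+ d * 'C(a./2 - c, d)%:R *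
      (1 / sin (pi * m%:R / k%:R) ^+ (2 * a./2 - 2 * d))).
  rewrite big_nat_cond [RHS]big_nat_cond; apply: eq_bigr => m /andP[/andP[m1 mk] cmk].
  apply: recot_cosec => //; apply: sin_pi_frac_neq0; rewrite m1 ltn_neqAle -ltnS mk.
  by rewrite andbT; apply: contraTneq cmk => ->; rewrite /coprime gcdnn gtn_eqF.
rewrite -mulr_sumr exchange_big; congr (_ * _); apply: eq_bigr => c _.
rewrite -mulr_sumr exchange_big; congr (_ * _); apply: eq_bigr => d _.
by rewrite -mulr_sumr.
Qed.

(** Since [a <= r], the excluded case [a - 2 d = r] forces [a = r] and [d = 0]. It occurs once for
    each [c], so the removed terms add up to [S r] times the constant from [sum_cosec_coef]. *)
Lemma sum_cosec_exclude r a (S : nat -> R) : (0 < a <= r)%N -> ~~ odd r ->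
  E_factor R a * (\sum_(0 <= c < a./2.+1) cosec_coef R a c *
    \sum_(0 <= d < (a./2 - c).+1)
      (-1) ^+ d * 'C(a./2 - c, d)%:R * S (2 * a./2 - 2 * d)%N) =
  E_factor R a * (\sum_(0 <= c < a./2.+1) cosec_coef R a c *
    \sum_(0 <= d < (a./2 - c).+1 | (a - 2 * d)%N != r)
      (-1) ^+ d * 'C(a./2 - c, d)%:R * S (2 * a./2 - 2 * d)%N)
  + (-1) ^+ r./2 / 2 ^+ r * S r * (a == r)%:R.
Proof.
move=> /andP[a0 ar] er.
have [{ar}ear|nar] := eqVneq a r; last first.
  rewrite mulr0 addr0; congr (_ * _); apply: eq_bigr => c _; congr (_ * _).
  rewrite [RHS]big_mkcond; apply: eq_bigr => d _.
  by have -> : (a - 2 * d != r)%N by apply/eqP; move: nar => /eqP; lia.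
rewrite {}ear in a0 *.
have e2 : (2 * r./2 = r)%N by have := odd_double_half r; rewrite (negbTE er); lia.
have r20 : (0 < r./2)%N by lia.
have := sum_cosec_coef R r20; rewrite e2 => <-.
rewrite mulr1 -mulrA -mulrDr; congr (_ * _).
rewrite mulr_suml -big_split; apply: eq_bigr => c _ /=.
rewrite -mulrDr; congr (_ * _).
rewrite big_ltn // [X in _ = X + _]big_ltn_cond // muln0 subn0 eqxx /=.
rewrite expr0 bin0 !mul1r addrC; congr (_ + _).
rewrite big_nat [RHS]big_nat_cond; apply: eq_bigl => d.
by case: ltnP => //= d0; case: ltnP => //= _; apply/esym/eqP; lia.
Qed.

End BernoulliSums.

(** * Equating the two evaluations and solving for [SIN R k r] *)

Theorem lemma3p3 (R : realType) (k : nat) (hk : (3 <= k)%N)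
    (r : nat) (hr0 : (0 < r)%N) (hr : ~~ odd r) :
  SIN R k r =
    (-1) ^+ (r./2 + 1) * 2 ^+ r * bernoulli_number R r / r`!%:R
      * jordan_totient R r k
    + (-1) ^+ r./2 * 2 ^+ r * k%:R ^+ (r - 1) / r`!%:R *
      \sum_(0 <= q < r.+1)
        'C(r, q)%:R * (bernoulli_number R q / k%:R ^+ (r - q)) *
        \sum_(1 <= j < (r - q).+1)
          'C(r - q, j)%:R * k%:R ^+ j *
          \sum_(1 <= a < (r - q - j + 1).+1)
            A_coef R (r - q - j) a * E_factor R a *
            \sum_(0 <= c < a./2.+1)
              (-1) ^+ (c + (a + 1)./2) * (a - c - 1)`!%:R
                / (2 ^+ (2 * c + 1) * c`!%:R * (2 * a./2 - 2 * c)`!%:R) *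
              \sum_(0 <= d < (a./2 - c).+1 | (a - 2 * d)%N != r)
                (-1) ^+ d * 'C(a./2 - c, d)%:R * SIN R k (2 * a./2 - 2 * d).
Proof.
have k1 : (1 < k)%N by apply: leq_trans hk.
have kn0 : k%:R != 0 :> R by rewrite pnatr_eq0 -lt0n ltnW.
pose K a := E_factor R a * \sum_(0 <= c < a./2.+1) cosec_coef R a c *
  \sum_(0 <= d < (a./2 - c).+1 | (a - 2 * d)%N != r)
    (-1) ^+ d * 'C(a./2 - c, d)%:R * SIN R k (2 * a./2 - 2 * d).
transitivity ((-1) ^+ (r./2 + 1) * 2 ^+ r * bernoulli_number R r / r`!%:R
      * jordan_totient R r k
    + (-1) ^+ r./2 * 2 ^+ r * k%:R ^+ (r - 1) / r`!%:R * bernoulli_sum r k K);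
  last first.
  congr (_ + _ * _); apply: eq_bigr => q _; congr (_ * _).
  apply: eq_bigr => j _; congr (_ * _); apply: eq_bigr => a _.
  by rewrite /K mulrA.
(* Both sides evaluate the sum of [cos_bernoulli R r k m] over [m] prime to [k]: by the sieve, and
   by cosecant powers with the contribution of [SIN R k r] set apart. *)
have : bernoulli_number R r * jordan_totient R r k =
    k%:R ^+ r / k%:R * (bernoulli_sum r k K
    + (-1) ^+ r./2 / 2 ^+ r * SIN R k r * ((-1) ^+ r.-1 * r`!%:R * (k%:R / k%:R ^+ r))).
  rewrite -sum_coprime_cos_bernoulli // -bernoulli_sum_top // -bernoulli_sumZ.
  rewrite -bernoulli_sumD.
  transitivity (\sum_(1 <= m < k.+1 | coprime m k) k%:R ^+ r / k%:R *
                 bernoulli_sum r k (recot (pi * m%:R / k%:R : R) 0)).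
    rewrite big_nat_cond [RHS]big_nat_cond.
    apply: eq_bigr => m /andP[/andP[m1 mk] cmk].
    apply: cos_bernoulliE; rewrite m1 ltn_neqAle -ltnS mk andbT.
    by apply: contraTneq cmk => ->; rewrite /coprime gcdnn gtn_eqF.
  rewrite -mulr_sumr -bernoulli_sum_sum; congr (_ * _).
  apply: eq_bernoulli_sum => a ar.
  rewrite sum_recot_cosec //; last by case/andP: ar.
  by rewrite (@sum_cosec_exclude R r).
move=> e.
have -> : (-1) ^+ (r./2 + 1) * 2 ^+ r * bernoulli_number R r / r`!%:R *
  jordan_totient R r k = - (-1) ^+ r./2 * 2 ^+ r / r`!%:R *
  (bernoulli_number R r * jordan_totient R r k) by rewrite exprD expr1; ring.
rewrite {}e.
have -> : (-1) ^+ r.-1 = -1 :> R.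
  by rewrite -signr_odd; have -> : odd r.-1 by lia.
have -> : k%:R ^+ (r - 1) = k%:R ^+ r / k%:R :> R.
  by rewrite -{2}(subnK hr0) exprD expr1 mulfK.
move: (fact_neq0 R r) (bernoulli_sum r k K) => rf T.
have : ((-1) ^+ r./2) ^+ 2 = 1 :> R by rewrite sqrr_sign.
have : 2 ^+ r != 0 :> R by rewrite expf_neq0.
have : k%:R ^+ r != 0 :> R by rewrite expf_neq0.
move: (_ ^+ r./2) (2 ^+ r) (k%:R ^+ r) (SIN R k r) => s t u S u0 t0 s1.
(* The two multiples of [T] cancel, and [S] is left with the square of the sign [s]. *)
transitivity (s ^+ 2 * S); first by rewrite s1 mul1r.
field.
by rewrite rf u0 t0 kn0.
Qed.
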